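(* For any oriented tree $\overrightarrow{T}$ on $n\ge 1$ vertices, $F(\overrightarrow{T})=n-1$.
   Context: A finite simple digraph $D=(V,A)$ has finite nonempty vertex set $V$ and arc set $A$ consisting of ordered pairs of distinct vertices (no loops, no parallel arcs). $N_D^+(v)=\{u:(v,u)\in A\}$. An oriented graph is a digraph in which $(u,v)\in A$ implies $(v,u)\notin A$. An oriented tree is an oriented graph whose underlying undirected graph is a tree. Zero forcing: for $S\subseteq V$ let $B^0(S)=S$ and $B^{i+1}(S)=B^i(S)\cup\{w:\{w\}=N_D^+(v)\setminus B^i(S)\text{ for some }v\in B^i(S)\}$. $S$ is a zero forcing set (ZFS) if $B^t(S)=V$ for some $t\ge 0$, and a failed zero forcing set (FZFS) otherwise. The failed zero forcing number $F(D)$ is the largest cardinality of an FZFS of $D$. *)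

(* Defs.v *)
From mathcomp Require Import all_boot.
From mathcomp Require Import boolp.

Set Implicit Arguments.
Unset Strict Implicit.
Unset Printing Implicit Defensive.

Record digraph := Digraph {
  vertex :> finType;
  arc : rel vertex;
  arc_irreflexive : irreflexive arc;
  vertex_nonempty : 0 < #|vertex|
}.

Section Digraph.
Variable D : digraph.
Implicit Types (S B : {set D}).

Definition out_nbhd (v : D) : {set D} := [set u | arc v u].

Definition force_step B : {set D} :=
  B :|: [set w | [exists v in B, out_nbhd v :\: B == [set w]]].

Definition forced (i : nat) S : {set D} := iter i force_step S.

Definition zero_forcing_set S : Prop := exists t, forced t S = [set: D].

Definition failed_zero_forcing_set S : Prop := ~ zero_forcing_set S.

(* The maximum is over a nonempty family, as [set0] is always a failed zero
   forcing set (see [failed_zero_forcing_set0]); the default value 0 of [\max]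
   therefore plays no role. *)
Definition failed_zero_forcing_number : nat :=
  \max_(S : {set D} | `[< failed_zero_forcing_set S >]) #|S|.

Definition oriented : Prop := forall u v : D, arc u v -> ~~ arc v u.

Definition underlying : rel D := fun u v => arc u v || arc v u.

End Digraph.

Definition connected_graph (V : finType) (e : rel V) : Prop :=
  forall u v : V, connect e u v.

(* [e] is meant to be symmetric and irreflexive: a cycle is then a closed walk
   through at least 3 distinct vertices (a [ucycle] of size 2 merely goes back
   and forth along one edge). *)
Definition acyclic_graph (V : finType) (e : rel V) : Prop :=
  forall c : seq V, 2 < size c -> ~ ucycle e c.

Definition tree (V : finType) (e : rel V) : Prop :=
  connected_graph e /\ acyclic_graph e.

Definition oriented_tree (D : digraph) : Prop :=
  oriented D /\ tree (@underlying D).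

Lemma failed_zero_forcing_set0 (D : digraph) :
  failed_zero_forcing_set (set0 : {set D}).
Proof.
case=> t; have -> : forced t (set0 : {set D}) = set0.
  elim: t => [//|t IHt]; rewrite /forced iterS -/(forced t _) IHt.
  apply/setP=> w; rewrite !inE /=.
  by apply/existsP=> -[v]; rewrite inE.
by move=> E; have := vertex_nonempty D; rewrite -cardsT -E cards0.
Qed.

(* Main.v *)
Require Import Defs.
From mathcomp Require Import all_boot.
From mathcomp Require Import boolp.

(** In a finite oriented tree some vertex [s] has no in-neighbour: otherwise,
    following in-neighbours backwards eventually closes up into a directed cycle,
    which has length at least 3 as there are no loops and no 2-cycles. Nothing can
    force [s], so [V \ {s}] is a failed zero forcing set, while [V] is not. *)

Lemma exists_fcycle_orbit (V : finType) (x0 : V) (f : V -> V) :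
  exists x, fcycle f (orbit f x).
Proof.
(* [order f] does not increase along [f], so a point minimizing it has the same
   order as its image, which means that it is periodic. *)
case: (@arg_minnP V x0 xpredT (order f)) => // x _ min_x; exists x.
apply/(orbitPcycle 0 1)/eqP.
rewrite eqn_leq min_x // andbT.
apply/subset_leq_card/subsetP=> y; rewrite !inE.
exact: connect_trans (fconnect1 f x).
Qed.

Lemma oriented_tree_source (D : digraph) :
  oriented_tree D -> exists s : D, forall v, ~~ Defs.arc v s.
Proof.
case=> asymD [_ acyclicD]; apply: contrapT => noSource.
have inN (v : D) : exists u, Defs.arc u v.
  apply: contrapT => noIn; apply: noSource; exists v => u.
  by apply/negP=> uv; apply: noIn; exists u.
pose f v := xchoose (inN v).
have fP v : Defs.arc (f v) v by exact: (xchooseP (inN v)).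
have /card_gt0P[x0 _] := vertex_nonempty D.
have [x cyc_x] := @exists_fcycle_orbit D x0 f.
apply: (acyclicD (orbit f x)); last first.
  apply/andP; split; last exact: orbit_uniq.
  (* The orbit of [f] runs against the arcs, which [underlying] ignores. *)
  apply: sub_cycle cyc_x => u v /eqP <-.
  by rewrite /underlying fP orbT.
rewrite size_orbit; move: cyc_x (order_gt0 f x); rewrite /orbit.
(* Length 1 would give a loop, length 2 a pair of opposite arcs. *)
case: (order f x) => [|[|[|k]]] //=.
  by rewrite andbT => /eqP fx; have := fP x; rewrite fx arc_irreflexive.
case/and3P=> _ /eqP ffx _ _.
by have := fP (f x); rewrite ffx (negPf (asymD _ _ (fP x))).
Qed.

Lemma failed_zero_forcing_setC1 (D : digraph) (s : D) :
  (forall v, ~~ Defs.arc v s) -> failed_zero_forcing_set [set~ s].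
Proof.
move=> sourceS [t].
(* Only [s] is left to force, and no arc enters it, so the process is stationary from the start. *)
have stepS : force_step [set~ s] = [set~ s].
  apply/setUidPl/subsetP=> w; rewrite inE => /existsP[v /andP[_ /eqP defw]].
  have := set11 w; rewrite -defw !inE negbK => /andP[/eqP ->].
  by rewrite (negPf (sourceS v)).
rewrite /forced iter_fix // => /setP/(_ s).
by rewrite !inE eqxx.
Qed.

Theorem corollary4p3 (T : digraph) (n : nat) (hT : oriented_tree T)
    (hn : #|T| = n) (n_ge1 : 1 <= n) :
  failed_zero_forcing_number T = n - 1.
Proof.
have [s sourceS] := oriented_tree_source _ hT.
apply/eqP; rewrite eqn_leq; apply/andP; split.
  apply/bigmax_leqP=> S /asboolP failS.
  rewrite -ltnS subn1 prednK // -hn ltn_neqAle max_card andbT.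
  (* A set of full cardinality is the whole vertex set, hence zero forcing at time 0. *)
  apply/negP=> fullS; apply: failS; exists 0; rewrite /forced /=.
  by apply/eqP; rewrite eqEcard subsetT cardsT (eqP fullS) leqnn.
have -> : n - 1 = #|[set~ s]| by rewrite cardsC1 hn subn1.
by apply: leq_bigmax_cond; apply/asboolP/failed_zero_forcing_setC1.
Qed.
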